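(* We have $\beta_3=\frac{95}{96}$, and for all $(x_1,x_2,x_3)\in\mathbb{R}^3$, $$\gamma_3(x_1,x_2,x_3)=q_3^\star(x_1,x_2)-q_3^\star(x_2,x_3)+\tilde r_3^\star(x_1,x_2,x_3)+\beta_3x_1^2,$$ where $$q_3^\star(x_1,x_2)=\frac16\left(x_2-\frac74x_1\right)^2+\frac16x_1^2\quad\text{and}\quad \tilde r_3^\star(x_1,x_2,x_3)=\frac16\left(x_3-\frac74x_2+x_1\right)^2.$$
   Context: $\gamma_3$ is the quadratic form on $\mathbb{R}^3$ given by $$\gamma_3(x_1,x_2,x_3)=\frac{11}{6}x_1^2-\frac{7}{6}x_1x_2+\frac13x_1x_3.$$ $\beta_3$ is defined as the supremum of the real numbers $\beta>0$ for which there exist a positive definite quadratic form $q_3$ on $\mathbb{R}^2$ and a positive definite quadratic form $\tilde r_3$ on $\mathbb{R}^3$ such that, for all $(x_1,x_2,x_3)\in\mathbb{R}^3$, $$\gamma_3(x_1,x_2,x_3)=q_3(x_1,x_2)-q_3(x_2,x_3)+\tilde r_3(x_1,x_2,x_3)+\beta x_1^2.$$ *)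

(* Defs.v *)
From mathcomp Require Import all_boot all_order all_algebra.
From mathcomp Require Import classical_sets reals.

Set Implicit Arguments.
Unset Strict Implicit.
Unset Printing Implicit Defensive.

Import Order.TTheory GRing.Theory Num.Theory.

Local Open Scope classical_set_scope.
Local Open Scope ring_scope.

Definition row2 (R : realType) (x1 x2 : R) : 'rV[R]_2 :=
  \row_(i < 2) [:: x1; x2]`_i.

Definition row3 (R : realType) (x1 x2 x3 : R) : 'rV[R]_3 :=
  \row_(i < 3) [:: x1; x2; x3]`_i.

Definition quadratic_form (R : realType) (n : nat) (q : 'rV[R]_n -> R) : Prop :=
  exists A : 'M[R]_n, forall x, q x = (x *m A *m x^T) 0 0.

Definition posdef_quadratic_form (R : realType) (n : nat)
    (q : 'rV[R]_n -> R) : Prop :=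
  quadratic_form q /\ (forall x, x != 0 -> 0 < q x).

Definition gamma3 (R : realType) (x : 'rV[R]_3) : R :=
  11 / 6 * x 0 0 ^+ 2 - 7 / 6 * x 0 0 * x 0 1 + 1 / 3 * x 0 0 * x 0 2.

(* [sup] is 0 on sets that are empty or unbounded above; a nonzero value is
   therefore a genuine least upper bound. *)
Definition beta3 (R : realType) : R :=
  sup [set beta : R | 0 < beta /\
    exists (q : 'rV[R]_2 -> R) (r : 'rV[R]_3 -> R),
      [/\ posdef_quadratic_form q, posdef_quadratic_form r &
          forall x1 x2 x3 : R,
            gamma3 (row3 x1 x2 x3) =
              q (row2 x1 x2) - q (row2 x2 x3) + r (row3 x1 x2 x3)
              + beta * x1 ^+ 2]].

Definition q3star (R : realType) (x : 'rV[R]_2) : R :=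
  1 / 6 * (x 0 1 - 7 / 4 * x 0 0) ^+ 2 + 1 / 6 * x 0 0 ^+ 2.

Definition r3star (R : realType) (x : 'rV[R]_3) : R :=
  1 / 6 * (x 0 2 - 7 / 4 * x 0 1 + x 0 0) ^+ 2.

(* Main.v *)
(** Testing the decomposition on the real and imaginary parts of
    $(1, z, z^2)$ with $|z| = 1$ cancels both [q]-terms, so that
    $\beta < \mathrm{Re}\,\gamma_3(1, z, z^2) = 3/2 - 7/6\,t + 2/3\,t^2$ where
    $t = \mathrm{Re}\, z$; the right-hand side is minimal, equal to $95/96$, at
    $t = 7/8$. Conversely $q_3^\star + \delta(2x_1^2 + x_2^2)$ and
    $\tilde r_3^\star + \delta(x_1^2 + x_2^2 + x_3^2)$ realise
    $\beta = 95/96 - 3\delta$, so the admissible [beta] form the open interval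
    from $0$ to $95/96$. *)
Require Import Defs.
From mathcomp Require Import all_boot all_order all_algebra.
From mathcomp Require Import classical_sets reals.
From mathcomp Require Import real_interval ring lra.

Import Order.TTheory GRing.Theory Num.Theory.

Local Open Scope ring_scope.

Lemma mulmx_quadE (R : realType) (n : nat) (A : 'M[R]_n) (x : 'rV[R]_n) :
  (x *m A *m x^T) 0 0 = \sum_i \sum_j x 0 i * A i j * x 0 j.
Proof.
rewrite mxE exchange_big; apply: eq_bigr => j _.
by rewrite !mxE mulr_suml.
Qed.

(** Unfolding sums with [big_ord_recl] produces iterated [lift]s, to be turned back into
    numerals. *)
Lemma ord2E : (lift ord0 ord0 = 1 :> 'I_2).
Proof. exact: val_inj. Qed.

Lemma ord3E :
  (lift ord0 ord0 = 1 :> 'I_3) * (lift ord0 (lift ord0 ord0) = 2 :> 'I_3).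
Proof. by split; apply: val_inj. Qed.

Lemma quadE2 (R : realType) (A : 'M[R]_2) (x : 'rV[R]_2) :
  (x *m A *m x^T) 0 0 =
    x 0 0 * A 0 0 * x 0 0 + x 0 0 * A 0 1 * x 0 1
    + (x 0 1 * A 1 0 * x 0 0 + x 0 1 * A 1 1 * x 0 1).
Proof. by rewrite mulmx_quadE !big_ord_recl !big_ord0 !ord2E !addr0. Qed.

Lemma quadE3 (R : realType) (A : 'M[R]_3) (x : 'rV[R]_3) :
  (x *m A *m x^T) 0 0 =
    x 0 0 * A 0 0 * x 0 0 + x 0 0 * A 0 1 * x 0 1 + x 0 0 * A 0 2 * x 0 2
    + (x 0 1 * A 1 0 * x 0 0 + x 0 1 * A 1 1 * x 0 1 + x 0 1 * A 1 2 * x 0 2)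
    + (x 0 2 * A 2 0 * x 0 0 + x 0 2 * A 2 1 * x 0 1 + x 0 2 * A 2 2 * x 0 2).
Proof.
by rewrite mulmx_quadE !big_ord_recl !big_ord0 !ord3E !addr0 !addrA.
Qed.

Lemma row2E (R : realType) (a b : R) :
  (row2 a b 0 0 = a) * (row2 a b 0 1 = b).
Proof. by rewrite /row2 !mxE. Qed.

Lemma row3E (R : realType) (a b c : R) :
  (row3 a b c 0 0 = a) * (row3 a b c 0 1 = b) * (row3 a b c 0 2 = c).
Proof. by rewrite /row3 !mxE. Qed.

Lemma sumsq2_gt0 (R : realType) (x : 'rV[R]_2) :
  x != 0 -> 0 < x 0 0 ^+ 2 + x 0 1 ^+ 2.
Proof.
move=> x0; rewrite lt_def addr_ge0 ?sqr_ge0// andbT.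
apply: contra x0; rewrite paddr_eq0 ?sqr_ge0// !sqrf_eq0 => /andP[/eqP x0 /eqP x1].
apply/eqP/rowP => -[[|[|//]] i]; rewrite mxE.
- by rewrite -[RHS]x0; congr (x _ _); exact: val_inj.
- by rewrite -[RHS]x1; congr (x _ _); exact: val_inj.
Qed.

Lemma sumsq3_gt0 (R : realType) (x : 'rV[R]_3) :
  x != 0 -> 0 < x 0 0 ^+ 2 + x 0 1 ^+ 2 + x 0 2 ^+ 2.
Proof.
move=> x0; rewrite lt_def !addr_ge0 ?sqr_ge0// andbT.
apply: contra x0; rewrite !paddr_eq0 ?addr_ge0 ?sqr_ge0// !sqrf_eq0.
move=> /andP[/andP[/eqP x0 /eqP x1] /eqP x2].
apply/eqP/rowP => -[[|[|[|//]]] i]; rewrite mxE.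
- by rewrite -[RHS]x0; congr (x _ _); exact: val_inj.
- by rewrite -[RHS]x1; congr (x _ _); exact: val_inj.
- by rewrite -[RHS]x2; congr (x _ _); exact: val_inj.
Qed.

(** [r3star] is a Fejér-Riesz factor: for $|z| = 1$ and $t = \mathrm{Re}\, z$, the excess over
    $95/96$ is $\frac23(t - \frac78)^2 = \frac16|z^2 - \frac74 z + 1|^2$. *)
Lemma gamma3_star (R : realType) (x1 x2 x3 : R) :
  gamma3 (row3 x1 x2 x3) =
    q3star (row2 x1 x2) - q3star (row2 x2 x3) + r3star (row3 x1 x2 x3)
    + 95 / 96 * x1 ^+ 2.
Proof. by rewrite /gamma3 /q3star /r3star !row3E !row2E; field. Qed.

Definition admissible (R : realType) (beta : R) : Prop :=
  exists (q : 'rV[R]_2 -> R) (r : 'rV[R]_3 -> R),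
    [/\ posdef_quadratic_form q, posdef_quadratic_form r &
        forall x1 x2 x3 : R,
          gamma3 (row3 x1 x2 x3) =
            q (row2 x1 x2) - q (row2 x2 x3) + r (row3 x1 x2 x3)
            + beta * x1 ^+ 2].

Lemma admissible_lt (R : realType) (beta : R) : admissible R beta -> beta < 95 / 96.
Proof.
move=> [q [r [[[A qE] _] [_ r_gt0] decomp]]].
(* With $\cos\theta = 7/8$ these are $(1, \cos\theta, \cos 2\theta)$ and
   $(0, \sin\theta, \sin 2\theta)/\sin\theta$; note $\sin^2\theta = 15/64$. *)
pose u : 'rV[R]_3 := row3 1 (7 / 8) (17 / 32).
pose v : 'rV[R]_3 := row3 0 1 (7 / 4).
have ru : 0 < r u.
  apply: r_gt0; apply/eqP => /rowP/(_ 0); rewrite row3E mxE => /eqP.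
  by rewrite oner_eq0.
have rv : 0 < r v.
  apply: r_gt0; apply/eqP => /rowP/(_ 1); rewrite row3E mxE => /eqP.
  by rewrite oner_eq0.
have := decomp 1 (7 / 8) (17 / 32); have := decomp 0 1 (7 / 4).
rewrite -/u -/v !qE !quadE2 !row2E /gamma3 !row3E => Ev Eu.
(* In [Eu] plus $15/64$ times [Ev] every entry of [A] cancels, leaving $95/96 = \beta + r(u) +
   \frac{15}{64} r(v)$. *)
lra.
Qed.

Lemma admissible_perturb (R : realType) (d : R) :
  0 < d -> admissible R (95 / 96 - 3 * d).
Proof.
move=> d_gt0.
(* [r3star] vanishes on a plane and needs a definite correction. The weights 2 and 1 telescope: all
   added terms sum to $3 d x_1^2$. *)
pose q (x : 'rV[R]_2) := q3star x + d * (2 * x 0 0 ^+ 2 + x 0 1 ^+ 2).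
pose r (x : 'rV[R]_3) :=
  r3star x + d * (x 0 0 ^+ 2 + x 0 1 ^+ 2 + x 0 2 ^+ 2).
exists q, r; split.
- split.
    exists (\matrix_(i < 2)
      [:: row2 (65 / 96 + 2 * d) (- (7 / 24)); row2 (- (7 / 24)) (1 / 6 + d)]`_i).
    by move=> x; rewrite quadE2 !mxE /q /q3star /=; field.
  move=> x x0; rewrite /q ltr_wpDl//.
    by rewrite /q3star addr_ge0// mulr_ge0 ?sqr_ge0// divr_ge0.
  rewrite mulr_gt0//; have := sumsq2_gt0 R x x0; have := sqr_ge0 (x 0 0).
  lra.
- split.
    (* The Gram matrix of $(1, -7/4, 1)$ scaled by $1/6$, plus [d] times the identity. *)
    exists (\matrix_(i < 3)
      [:: row3 (1 / 6 + d) (- (7 / 24)) (1 / 6);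
          row3 (- (7 / 24)) (49 / 96 + d) (- (7 / 24));
          row3 (1 / 6) (- (7 / 24)) (1 / 6 + d)]`_i).
    by move=> x; rewrite quadE3 !mxE /r /r3star /=; field.
  move=> x x0; rewrite /r ltr_wpDl//.
    by rewrite /r3star mulr_ge0 ?sqr_ge0// divr_ge0.
  by rewrite mulr_gt0//; exact: sumsq3_gt0.
- move=> x1 x2 x3; rewrite gamma3_star /q /r !row3E !row2E.
  by ring.
Qed.

Lemma beta3E (R : realType) : beta3 R = 95 / 96.
Proof.
(* [BRight 0] and [true] make both ends open; the side goal is that []0, 95/96[] is nonempty. *)
rewrite -[RHS](@sup_itv R (BRight 0) true); last by rewrite bnd_simp; lra.
rewrite /beta3; congr sup; apply/seteqP; split => b /=; rewrite in_itv/=.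
  by move=> [-> /admissible_lt ->].
move=> /andP[b_gt0 b_lt]; split=> //.
have -> : b = 95 / 96 - 3 * ((95 / 96 - b) / 3) by field.
by apply: admissible_perturb; lra.
Qed.

Theorem theorem2p2 (R : realType) :
  beta3 R = 95 / 96 /\
  forall x1 x2 x3 : R,
    gamma3 (row3 x1 x2 x3) =
      q3star (row2 x1 x2) - q3star (row2 x2 x3) + r3star (row3 x1 x2 x3)
      + beta3 R * x1 ^+ 2.
Proof. by rewrite beta3E; split=> // x1 x2 x3; exact: gamma3_star. Qed.
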